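(* Let $\mathcal{H}\subseteq\mathbb{R}^n$ be an affine subspace (not necessarily generic) and let $\mathcal{P}=[0,1]^n\cap\mathcal{H}$, with vertex set $V$. Then there exist Bernstein polynomials $P_v(x)$, one for each vertex $v\in V$, such that the Bernoulli race over the Bernstein polynomials $\{P_v\}_{v\in V}$ is a Bernoulli factory for $\mathcal{P}$.
   Context: A Bernstein monomial is $\prod_{i=1}^n x_i^{a_i}(1-x_i)^{b_i}$ with nonnegative integers $a_i,b_i$; a Bernstein polynomial is a finite combination $\sum_j c_jM_j(x)$ of Bernstein monomials with positive coefficients $c_j$. A Bernoulli factory with output set $V$ (for inputs $x\in[0,1]^n$) is a (possibly infinite) rooted binary tree whose internal nodes are labeled by an index $i\in[n]$ or a known constant $c\in(0,1)$ and whose leaves are labeled by elements of $V$; on input $x$ one walks from the root, at a node labeled $i$ flipping a fresh independent coin that is $1$ with probability $x_i$ (an $x_i$-coin), at a node labeled $c$ a fresh coin of bias $c$, following the edge labeled by the outcome, and outputs the label of the leaf reached; $\mathcal{F}(x)$ is the output ($\emptyset$ if no leaf is reached). A Bernoulli factory for the polytope $\mathcal{P}$ is such a factory with output set $V$ that terminates almost surely (i.e. $\Pr[\mathcal{F}(x)=\emptyset]=0$) and satisfies $\mathbb{E}[\mathcal{F}(x)]=x$ for all $x\in\mathcal{P}\cap(0,1)^n$. The Bernoulli race over Bernstein polynomials $\{P_v\}_{v\in V}$ is the following factory: fix a constant $C\ge1$ at least the sum of the coefficients of every $P_v$. In each round, pick $v\in V$ uniformly at random; writing $P_v=\sum_j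 c_jM_j$, select monomial $M_j$ with probability $c_j/C$ (with the remaining probability select none, which counts as failure); if $M_j=\prod_i x_i^{a_i}(1-x_i)^{b_i}$ is selected, flip the $x_i$-coin $a_i+b_i$ times for each $i$, and declare success iff for every $i$ the first $a_i$ flips are $1$ and the next $b_i$ flips are $0$. On success output $v$; otherwise start a new round. *)

(* Defs.v *)
From HB Require Import structures.
From mathcomp Require Import all_boot all_order all_algebra.
From mathcomp Require Import all_classical all_reals all_analysis.
Set Implicit Arguments. Unset Strict Implicit. Unset Printing Implicit Defensive.
Import Order.TTheory GRing.Theory Num.Theory.
Import numFieldNormedType.Exports.
Local Open Scope classical_set_scope.
Local Open Scope ring_scope.

Section BernoulliRace.
Variables (R : realType) (n : nat).

(* The nonempty affine subspace p + rowspace(U). Every affine subspace of R^n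
   has this form. *)
Definition affine_sub (p : 'rV[R]_n) (U : 'M[R]_n) : set 'rV[R]_n :=
  [set x | (x - p <= U)%MS].

Definition unit_cube : set 'rV[R]_n :=
  [set x | forall i : 'I_n, 0 <= x ord0 i <= 1].
Definition open_unit_cube : set 'rV[R]_n :=
  [set x | forall i : 'I_n, 0 < x ord0 i < 1].

Definition is_vertex (P : set 'rV[R]_n) (v : 'rV[R]_n) : Prop :=
  P v /\ forall (y z : 'rV[R]_n) (t : R), P y -> P z -> 0 < t < 1 ->
    v = t *: y + (1 - t) *: z -> y = z.

(* A term c * prod_i x_i^(a_i) (1-x_i)^(b_i) of a Bernstein polynomial. *)
Record bterm := BTerm {
  bcoef : R;
  bexp1 : {ffun 'I_n -> nat};
  bexp0 : {ffun 'I_n -> nat}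
}.

Definition bmono (t : bterm) (x : 'rV[R]_n) : R :=
  \prod_(i < n) (x ord0 i ^+ bexp1 t i * (1 - x ord0 i) ^+ bexp0 t i).

Definition bernstein_poly (P : seq bterm) : bool :=
  all (fun t => 0 < bcoef t) P.

Definition bcoef_sum (P : seq bterm) : R := \sum_(t <- P) bcoef t.

(* Probability that one round of the Bernoulli race over Ps (constant C)
   succeeds and outputs the k-th element: v_k is chosen with prob 1/|V|,
   monomial M_j with prob c_j / C, and the coin flips all succeed with
   probability M_j(x) (independent fresh coins). *)
Definition round_success (Ps : seq (seq bterm)) (C : R) (k : nat)
  (x : 'rV[R]_n) : R :=
  (size Ps)%:R^-1 * \sum_(t <- nth [::] Ps k) (bcoef t / C * bmono t x).

Definition round_fail (Ps : seq (seq bterm)) (C : R) (x : 'rV[R]_n) : R :=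
  1 - \sum_(k < size Ps) round_success Ps C k x.

(* Rounds are independent: the output is v_k with probability
   sum_{r>=0} fail^r * success_k, and the race never halts with
   probability lim_r fail^r. *)
Definition race_out_prob (Ps : seq (seq bterm)) (C : R) (k : nat)
  (x : 'rV[R]_n) (pr : R) : Prop :=
  (fun N : nat => \sum_(r < N) round_fail Ps C x ^+ r * round_success Ps C k x)
    @ \oo --> pr.

Definition race_never_halts_prob_zero (Ps : seq (seq bterm)) (C : R)
  (x : 'rV[R]_n) : Prop :=
  (fun r : nat => round_fail Ps C x ^+ r) @ \oo --> (0 : R).

Definition race_is_factory (P : set 'rV[R]_n) (vs : seq 'rV[R]_n)
  (Ps : seq (seq bterm)) (C : R) : Prop :=
  forall x : 'rV[R]_n, P x -> open_unit_cube x ->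
    race_never_halts_prob_zero Ps C x /\
    exists pr : 'I_(size vs) -> R,
      (forall k : 'I_(size vs), race_out_prob Ps C k x (pr k)) /\
      \sum_(k < size vs) pr k *: nth 0 vs k = x.

End BernoulliRace.

(* Main.v *)
Require Import Defs.
From HB Require Import structures.
From mathcomp Require Import all_boot all_order all_algebra.
From mathcomp Require Import all_classical all_reals all_analysis.
From mathcomp Require Import ring lra zify.
Set Implicit Arguments. Unset Strict Implicit. Unset Printing Implicit Defensive.
Import Order.TTheory GRing.Theory Num.Theory.
Import numFieldNormedType.Exports.
Local Open Scope ring_scope.

(** The weights are Warren's polynomial barycentric coordinates. Parametrize the
    affine subspace by z in R^d, so that the facets of the cube become
    inequalities y_l(z) = b_l + <z, a_l> >= 0. A tuple f of d facets with
    independent normals determines a basic point z_f, where y_(f j) = 0 for all j.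
    Shift b to a generic b', so that the perturbed polytope is simple, and call f
    chosen when its perturbed basic point is feasible; if the shift is small
    then z_f is a vertex of the original polytope for every chosen f. The claim is

      sum_(f chosen) |det a_f| / prod_j y_(f j)(z) (z_f - z) = 0,

    which becomes a Bernstein identity after clearing denominators. Cramer's rule
    gives |det a_f| (z_f - z) = - sgn(det a_f) sum_i y_(f i)(z) adj(a_f)_i. In the
    i-th summand the product of the 1/y_(f j) with j <> i and the row adj(a_f)_i
    do not depend on f i, so it remains to see that for fixed (f j)_(j <> i) the
    signs of det a_f over the chosen f cancel. These f are the end points of
    an edge of the perturbed polytope, if there are any: there are exactly two, and
    they have opposite signs because the edge leaves one facet and hits the other. *)

(** * Arrangements of half-spaces *)

(** With [S] the sum of the ratios [|e i| / |c i|], the step [1 / (1 + S)] serves all [i] at once.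
    Moving [c] by [t * e] then changes no nonzero sign. *)
Lemma small_step (R : realFieldType) (I : finType) (c e : I -> R) :
  exists2 t : R, 0 < t & forall i, c i != 0 -> `|t * e i| < `|c i|.
Proof.
pose S := \sum_(i | c i != 0) `|e i| / `|c i|.
have S_ge0 : 0 <= S by apply: sumr_ge0 => i _; rewrite divr_ge0.
have S1 : 0 < 1 + S by rewrite ltr_pwDl.
exists (1 + S)^-1; first by rewrite invr_gt0.
move=> i ci; have ci0 : 0 < `|c i| by rewrite normr_gt0.
rewrite normrM ger0_norm ?invr_ge0 ?ltW // mulrC ltr_pdivrMr //.
rewrite mulrC -ltr_pdivrMr // ltr_pwDl // /S (bigD1 i) //= lerDl.
by apply: sumr_ge0 => j _; rewrite divr_ge0.
Qed.

(** The functionals are treated one at a time. One that vanishes at the current point, but not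
    identically, is made nonzero by a step too small to change any nonzero sign. *)
Lemma perturbation (R : realFieldType) (L I : finType)
    (phi : I -> (L -> R) -> R) (b : L -> R) :
    (forall i y v t, phi i (fun l => y l + t * v l) = phi i y + t * phi i v) ->
  exists b' : L -> R, forall i,
    [/\ 0 < phi i b -> 0 < phi i b', phi i b < 0 -> phi i b' < 0 &
        (exists v, phi i v != 0) -> phi i b' != 0].
Proof.
move=> phi_lin.
suff /(_ (enum I)) [b' hb'] : forall s : seq I, exists b' : L -> R, forall i,
    [/\ 0 < phi i b -> 0 < phi i b', phi i b < 0 -> phi i b' < 0 &
        i \in s -> (exists v, phi i v != 0) -> phi i b' != 0].
  by exists b' => i; have [? ? ne0] := hb' i; split=> //; apply: ne0; rewrite mem_enum.
elim=> [|i0 s [b1 hb1]]; first by exists b => i; split.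
have [e0|ne0] := eqVneq (phi i0 b1) 0; last first.
  exists b1 => i; have [? ? hne0] := hb1 i; split=> //.
  by rewrite inE => /predU1P[->|/hne0].
have [[v hv]|nov] := pselect (exists v, phi i0 v != 0); last first.
  exists b1 => i; have [? ? hne0] := hb1 i; split=> //.
  by rewrite inE => /predU1P[->|/hne0].
have [t t0 ht] := small_step (phi ^~ b1) (phi ^~ v).
exists (fun l => b1 l + t * v l) => i; rewrite phi_lin.
have [pos neg hne0] := hb1 i; have {}ht := ht i; split.
- move=> /pos p1; move: ht; rewrite gt_eqF // (gtr0_norm p1) => /(_ isT).
  by rewrite ltr_norml; lra.
- move=> /neg p1; move: ht; rewrite lt_eqF // (ltr0_norm p1) => /(_ isT).
  by rewrite ltr_norml; lra.
rewrite inE => /predU1P[->|si ex]; first by rewrite e0 add0r mulf_neq0 ?(lt0r_neq0 t0).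
have n1 := hne0 si ex; have {ht} := ht n1.
by apply: contraTneq => /eqP; rewrite addr_eq0 => /eqP ->; rewrite normrN ltxx.
Qed.

Section Arrangement.
Variables (R : realFieldType) (d : nat) (L : finType) (a : L -> 'cV[R]_d).
Implicit Types (b : L -> R) (z u : 'rV[R]_d) (f g : {ffun 'I_d -> L}) (l : L).

Definition slope u l : R := (u *m a l) 0 0.
Definition height b z l : R := b l + slope z l.
Definition feasible b z := forall l, 0 <= height b z l.
Definition normals f : 'M[R]_d := \matrix_(k, i) a (f i) k 0.
Definition basic_point b f : 'rV[R]_d := - (\row_i b (f i)) *m invmx (normals f).

Lemma slopeD u v l : slope (u + v) l = slope u l + slope v l.
Proof. by rewrite /slope mulmxDl mxE. Qed.
Lemma slopeZ t u l : slope (t *: u) l = t * slope u l.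
Proof. by rewrite /slope -scalemxAl mxE. Qed.
Lemma slopeB u v l : slope (u - v) l = slope u l - slope v l.
Proof. by rewrite /slope mulmxBl !mxE. Qed.

Lemma heightD b z u l : height b (z + u) l = height b z l + slope u l.
Proof. by rewrite /height slopeD addrA. Qed.

Lemma slope_normals u f i : (u *m normals f) 0 i = slope u (f i).
Proof. by rewrite /slope !mxE; apply: eq_bigr => k _; rewrite mxE. Qed.

Lemma height_basic_point b f i :
  \det (normals f) != 0 -> height b (basic_point b f) (f i) = 0.
Proof.
move=> df; rewrite /height -slope_normals /basic_point -mulmxA mulVmx ?unitmxE ?unitfE //.
by rewrite mulmx1 !mxE subrr.
Qed.

Lemma slope_eq0 f u : \det (normals f) != 0 ->
  (forall i, slope u (f i) = 0) -> u = 0.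
Proof.
move=> df u0; have uf : normals f \in unitmx by rewrite unitmxE unitfE.
rewrite -[u](mulmxK uf).
suff -> : u *m normals f = 0 by rewrite mul0mx.
by apply/rowP => i; rewrite slope_normals u0 mxE.
Qed.

Lemma basic_point_unique b f z : \det (normals f) != 0 ->
  (forall i, height b z (f i) = 0) -> z = basic_point b f.
Proof.
move=> df z0; apply/eqP; rewrite -subr_eq0; apply/eqP/(slope_eq0 df) => i.
have := z0 i; have := height_basic_point b i df; rewrite /height slopeB; lra.
Qed.

Lemma normals_basis (T : {pred L}) :
    (forall u, (forall l, l \in T -> slope u l = 0) -> u = 0) ->
  exists2 f, \det (normals f) != 0 & forall i, f i \in T.
Proof.
move=> T_spans.
(* Normals outside [T] become zero rows, which keeps [L] as the index set; a nonsingular selection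
   of rows avoids them. *)
pose N : 'M[R]_(#|L|, d) :=
  \matrix_(k, j) if enum_val k \in T then a (enum_val k) j 0 else 0.
have fullN : row_full N.
  rewrite -cokermx_eq0 -trmx_eq0; apply/eqP/row_matrixP => i; rewrite row0.
  apply: T_spans => l Tl; rewrite -tr_col /slope.
  have := congr1 (fun A : 'M[R]_(_, d) => A (enum_rank l) i) (mulmx_coker N).
  rewrite !mxE => {2}<-; apply: eq_bigr => k _.
  by rewrite !mxE enum_rankK Tl mulrC.
pose f : {ffun 'I_d -> L} := [ffun i => enum_val (fullrankfun fullN i)].
have dN : \det (rowsub (fullrankfun fullN) N) != 0.
  by rewrite -unitfE -unitmxE fullrowsub_unit.
have fT i : f i \in T.
  apply: contra_neqT dN => fi; rewrite (expand_det_row _ i) big1 // => j _.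
  by rewrite !mxE; rewrite ffunE in fi; rewrite (negPf fi) mul0r.
exists f => //; rewrite -det_tr; apply: etrans dN; congr (\det _ != 0).
by apply/matrixP => i j; rewrite !mxE; have := fT i; rewrite ffunE => ->.
Qed.

(** The recession cone is trivial, so every ray leaves the feasible set. *)
Hypothesis bounded : forall u, u != 0 -> exists l, slope u l < 0.

(** The ratio test of the simplex method: the first facet hit minimizes [T] among those that
    decrease along [u]. *)
Lemma ray_exit b z u : feasible b z -> u != 0 -> exists t l,
  [/\ 0 <= t, slope u l < 0, height b (z + t *: u) l = 0 &
      feasible b (z + t *: u)].
Proof.
move=> zQ /bounded [l0 ul0].
pose T l := height b z l / - slope u l.
have [l ul lmin] := arg_minP T (P := fun l => slope u l < 0) ul0.
have t0 : 0 <= T l by rewrite divr_ge0 // oppr_ge0 ltW.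
exists (T l), l; split=> // [|k]; rewrite heightD slopeZ.
  by rewrite /T; field; rewrite lt_eqF.
have [uk|uk] := ltP (slope u k) 0; last exact: addr_ge0 (zQ k) (mulr_ge0 t0 uk).
have := lmin k uk; rewrite /T ler_pdivlMr ?oppr_gt0 //; lra.
Qed.

(** As long as the tight normals do not span, move in a direction that keeps them tight until a
    further facet becomes tight. The induction is on the number of facets that are not tight. *)
Lemma feasible_basic_point b z : feasible b z ->
  exists2 f, \det (normals f) != 0 & feasible b (basic_point b f).
Proof.
pose tight z := [set l | height b z l == 0]%SET.
move: {2}(#|L| - #|tight z|).+1 (ltnSn (#|L| - #|tight z|)) => m.
elim: m z => // m IH z hm zQ.
have [[u [u0 uT]]|nou] := pselect (exists u, u != 0 /\
    forall l, l \in tight z -> slope u l = 0).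
  have [t [l [t0 ul hl zQ']]] := ray_exit zQ u0.
  apply: (IH (z + t *: u)) => //.
  have sub : tight z \proper tight (z + t *: u).
    apply/properP; split.
      apply/fintype.subsetP => k kz; move: (kz); rewrite !inE heightD slopeZ (uT k kz) => /eqP->.
      by rewrite mulr0 addr0.
    exists l; rewrite !inE ?hl //; apply: contraTN ul => hl0.
    by rewrite uT ?ltxx // inE.
  have le : (#|tight (z + t *: u)%R| <= #|L|)%N by apply: max_card.
  by move: (proper_card sub) le hm; lia.
have [u uT|f df fT] := @normals_basis (mem (tight z)).
  by apply/eqP; apply: contra_notT nou => u0; exists u.
exists f => //; rewrite -(basic_point_unique (z := z)) // => i.
by have := fT i; rewrite !inE => /eqP.
Qed.

(** * Edges and the cancellation of signs *)

Definition replace f i l : {ffun 'I_d -> L} := [ffun j => if j == i then l else f j].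

Lemma replaceK f i l l' : replace (replace f i l) i l' = replace f i l'.
Proof. by apply/ffunP => j; rewrite !ffunE; case: eqP. Qed.

Lemma replace_id f i : replace f i (f i) = f.
Proof. by apply/ffunP => j; rewrite !ffunE; case: eqP => // ->. Qed.

(** A direction along which the heights of all [f j] with [j != i] are constant. The adjugate,
    unlike the inverse, makes it independent of [f i]. *)
Definition edge f i : 'rV[R]_d := row i (\adj (normals f)).

Lemma edge_replace f i l : edge (replace f i l) i = edge f i.
Proof.
apply/rowP => k; rewrite !mxE /cofactor; congr (_ * \det _).
by apply/matrixP => r c; rewrite !mxE ffunE eq_sym (negPf (neq_lift i c)).
Qed.

(** This turns signs of slopes along an edge into signs of determinants. *)
Lemma slope_edge f i l : slope (edge f i) l = \det (normals (replace f i l)).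
Proof.
rewrite (expand_det_col _ i) -(edge_replace f i l) /slope mxE.
by apply: eq_bigr => k _; rewrite !mxE ffunE eqxx mulrC.
Qed.

Lemma slope_edge_normals f i j :
  slope (edge f i) (f j) = \det (normals f) *+ (i == j).
Proof.
have -> : slope (edge f i) (f j) = (\adj (normals f) *m normals f) i j.
  by rewrite -slope_normals !mxE; apply: eq_bigr => k _; rewrite !mxE.
by rewrite mul_adj_mx !mxE.
Qed.

(* [b] stands for the perturbed constants, and [chosen b f] says that [f] is a
   feasible basis of the perturbed system. *)
Definition chosen b f : bool :=
  (\det (normals f) != 0) && [forall l, 0 <= height b (basic_point b f) l].

(** Simplicity of the whole arrangement: it is demanded at infeasible basic points too. *)
Definition generic b := forall f l, \det (normals f) != 0 ->
  height b (basic_point b f) l = 0 -> exists i, f i = l.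

Definition signed b f : R := Num.sg (\det (normals f)) *+ chosen b f.

(* Leave the vertex [g] along its [i]-th edge, in the direction in which the facet
   [g i] is relaxed. The edge ends at the first facet [l1] that it meets; by
   genericity no other basis on that line is feasible, and [l1] decreases where
   [g i] increases, so that the two determinants have opposite signs. *)
Lemma sum_edge_chosen b g i : generic b -> chosen b g ->
  \sum_l signed b (replace g i l) = 0.
Proof.
move=> gen /andP[dg /forallP gQ].
set z0 := basic_point b g in gQ.
(* The sign orients the edge so that the height of [g i] increases along [u]. *)
pose s := Num.sg (\det (normals g)).
pose u := s *: edge g i.
have uE l : slope u l = s * \det (normals (replace g i l)).
  by rewrite slopeZ slope_edge.
have uj j : j != i -> slope u (g j) = 0.
  by move=> ji; rewrite slopeZ slope_edge_normals eq_sym (negPf ji) mulr0.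
have ui : 0 < slope u (g i).
  by rewrite uE replace_id -normrEsg normr_gt0.
have u0 : u != 0.
  by apply: contraTneq ui => ->; rewrite /slope mul0mx mxE ltxx.
have z0i : height b z0 (g i) = 0 by apply: height_basic_point.
have [t [l1 [t_ge0 ul1 z1l1 z1Q]]] := ray_exit (gQ : feasible b z0) u0.
set z1 := z0 + t *: u in z1l1 z1Q.
have l1P j : g j != l1.
  apply: contraTneq ul1 => <-; rewrite -leNgt.
  by have [->|/uj->//] := eqVneq j i; apply: ltW.
have t_gt0 : 0 < t.
  rewrite lt_def t_ge0 andbT; apply: contra_eq_neq z1l1 => t0.
  rewrite /z1 t0 scale0r addr0; apply/eqP => /(gen _ _ dg) [j /eqP].
  by rewrite (negPf (l1P j)).
pose g1 := replace g i l1.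
have dg1 : \det (normals g1) != 0.
  by apply: contraTneq ul1 => e; rewrite uE e mulr0 ltxx.
have z1E : z1 = basic_point b g1.
  apply: basic_point_unique => // j; rewrite ffunE; case: eqP => // /eqP ji.
  by rewrite heightD slopeZ uj // mulr0 addr0 height_basic_point.
(* Such a basic point is [z0 + k *: u], and feasibility at [g i] and [l1] forces [0 <= k <= t]. By
   genericity the height of [l] is positive at both ends [z0] and [z1], hence also in between, so it
   cannot vanish there. *)
have only l : l != g i -> l != l1 -> chosen b (replace g i l) = false.
  move=> li ll1; apply/negP => /andP[dl /forallP lQ].
  set g2 := replace g i l in dl lQ; set z2 := basic_point b g2 in lQ.
  have ul : slope u l != 0 by rewrite uE mulf_neq0 ?sgr_eq0.
  have z2l : height b z2 l = 0.
    by rewrite -(height_basic_point b i dl) ffunE eqxx.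
  pose k := height b z2 (g i) / slope u (g i).
  have z2E : z2 = z0 + k *: u.
    apply/eqP; rewrite -subr_eq0; apply/eqP/(slope_eq0 dg) => j.
    rewrite slopeB slopeD slopeZ.
    have [->|ji] := eqVneq j i.
      rewrite /k divfK ?gt_eqF //; move: z0i; rewrite /height; lra.
    rewrite (uj _ ji) mulr0 addr0.
    have := height_basic_point b j dl; have := height_basic_point b j dg.
    rewrite ffunE (negPf ji) /height -/z0 -/z2; lra.
  have zl0 : height b z0 l != 0.
    apply/eqP => /(gen _ _ dg) [j jl]; have [ji|ji] := eqVneq j i.
      by rewrite -jl ji eqxx in li.
    by rewrite -jl uj ?eqxx in ul.
  have zl1 : height b z1 l != 0.
    apply/eqP; rewrite z1E => /(gen _ _ dg1) [j]; rewrite ffunE.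
    case: eqP => [_ e|/eqP ji jl]; first by rewrite e eqxx in ll1.
    by rewrite -jl uj ?eqxx in ul.
  have k0 : 0 <= k by rewrite divr_ge0 ?lQ ?ltW.
  have kt : k <= t.
    have := lQ l1; move: z1l1; rewrite z2E /z1 !heightD (slopeZ t) (slopeZ k) => e1 e2.
    have : 0 <= (k - t) * slope u l1 by lra.
    by rewrite nmulr_lge0 // subr_le0.
  have zl0' : 0 < height b z0 l by rewrite lt_def zl0 gQ.
  have zl1' : 0 < height b z1 l by rewrite lt_def zl1 z1Q.
  move: z2l zl1' zl0'; rewrite z2E /z1 !heightD (slopeZ t) (slopeZ k); nra.
have l1i : l1 != g i by rewrite eq_sym.
rewrite (bigD1 (g i)) //= (bigD1 l1) //= big1 ?addr0 => [|l /andP[li ll1]]; last first.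
  by rewrite /signed only.
have -> : signed b (replace g i l1) = - s.
  have -> : signed b g1 = Num.sg (\det (normals g1)).
    by rewrite /signed /chosen dg1 -z1E; case: forallP.
  apply: (mulfI (x := s)); first by rewrite sgr_eq0.
  move: ul1; rewrite uE mulrN -{2}[s]sgr_id /s sgr_id -/s -expr2 sqr_sg dg -sgr_cp0.
  by rewrite sgrM sgr_id => /eqP.
rewrite replace_id /signed /chosen dg (introT forallP gQ) subrr //.
Qed.

Lemma sum_edge b f i : generic b -> \sum_l signed b (replace f i l) = 0.
Proof.
move=> gen; have [l0 ch|none] := pickP (fun l => chosen b (replace f i l)).
  rewrite -[RHS](sum_edge_chosen i gen ch).
  by apply: eq_bigr => l _; rewrite replaceK.
by apply: big1 => l _; rewrite /signed none.
Qed.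

(** Group the [f] by their values off [i]; [key] masks the [i]-th value by [None]. *)
Lemma sum_replace (V : nmodType) i (F : {ffun 'I_d -> L} -> V) :
  (forall f, \sum_l F (replace f i l) = 0) -> \sum_f F f = 0.
Proof.
move=> F0; pose key f := [ffun j => if j == i then None else Some (f j)].
rewrite (partition_big key xpredT) //=; apply: big1 => k _.
have [f /eqP <-|none] := pickP (fun f => key f == k); last by rewrite big_pred0.
rewrite (reindex_onto (replace f i) (fun f' => f' i)) => [|f' /eqP /ffunP kf].
  rewrite -[RHS](F0 f); apply: eq_bigl => l; rewrite ffunE eqxx eqxx andbT.
  by apply/eqP/ffunP => j; rewrite !ffunE; case: eqP.
by apply/ffunP => j; have := kf j; rewrite !ffunE; case: eqP => [->|_ []].
Qed.

(** * The barycentric identity *)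

Lemma slope_sum (I : Type) (r : seq I) (P : pred I) (F : I -> 'rV[R]_d) l :
  slope (\sum_(i <- r | P i) F i) l = \sum_(i <- r | P i) slope (F i) l.
Proof. by rewrite /slope mulmx_suml summxE. Qed.

(** Cramer's rule, checked on slopes: both sides agree against every normal of the basis. *)
Lemma basic_pointB b f z : \det (normals f) != 0 ->
  \det (normals f) *: (basic_point b f - z) =
  - \sum_i height b z (f i) *: edge f i.
Proof.
move=> df; apply/eqP; rewrite -addr_eq0; apply/eqP/(slope_eq0 df) => j.
rewrite slopeD slopeZ slopeB slope_sum (bigD1 j) //= big1 => [|i ij].
  have := height_basic_point b j df.
  rewrite slopeZ slope_edge_normals eqxx mulr1n addr0 mulrC -mulrDl /height => h.
  by apply/eqP; rewrite mulf_eq0; apply/orP; left; apply/eqP; lra.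
by rewrite slopeZ slope_edge_normals (negPf ij) mulr0.
Qed.

(* The exponent [d - multiplicity] (never truncated) rather than the indicator of
   [l] not being in [f] makes the weight equal to [prod_l y_l^d / prod_j y_(f j)]
   without requiring [f] to be injective. *)
Definition weight b' (y : L -> R) f : R :=
  `|\det (normals f)| *+ chosen b' f *
  \prod_l y l ^+ (d - #|[set j | f j == l]%SET|).

Lemma prod_multiplicity (y : L -> R) f :
  \prod_l y l ^+ #|[set j | f j == l]%SET| = \prod_j y (f j).
Proof.
rewrite (partition_big f xpredT) //=; apply: eq_bigr => l _.
rewrite (eq_bigr (fun=> y l)) => [|j /eqP->//].
by rewrite prodr_const; congr (_ ^+ _); apply: eq_card => j; rewrite inE.
Qed.

Lemma weightE b' y f : (forall l, y l != 0) ->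
  weight b' y f =
  `|\det (normals f)| *+ chosen b' f * (\prod_l y l ^+ d / \prod_j y (f j)).
Proof.
move=> y0; rewrite /weight -(prod_multiplicity y) -prodfV -big_split /=.
congr (_ * _); apply: eq_bigr => l _; rewrite exprB ?unitfE //.
by rewrite -[X in (_ <= X)%N](card_ord d) max_card.
Qed.

(** The signs cancel because of [b'], which only selects the contributing [f]; Cramer's rule is
    applied with [b], so the identity holds for the unperturbed basic points. *)
Lemma sum_weight b b' z : generic b' -> (forall l, height b z l != 0) ->
  \sum_f weight b' (height b z) f *: basic_point b f =
  (\sum_f weight b' (height b z) f) *: z.
Proof.
move=> gen; set y := height b z => y0.
apply/eqP; rewrite -subr_eq0 scaler_suml -sumrB; apply/eqP.
(* With the factor [y (f i)] cancelled, this depends on [f i] only through [signed]. *)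
pose T f i := (signed b' f / \prod_(j | j != i) y (f j)) *: edge f i.
have T0 i : \sum_f T f i = 0.
  apply: (sum_replace (i := i)) => f; rewrite /T.
  rewrite (eq_bigr (fun l => signed b' (replace f i l) *:
    ((\prod_(j | j != i) y (f j))^-1 *: edge f i))) => [|l _].
    by rewrite -scaler_suml sum_edge ?scale0r.
  rewrite edge_replace scalerA; congr (_ / _ *: _).
  by apply: eq_bigr => j /negPf ji; rewrite ffunE ji.
pose D := \prod_l y l ^+ d.
transitivity (\sum_f - (D *: \sum_i T f i)); last first.
  rewrite sumrN -scaler_sumr exchange_big /= (eq_bigr (fun=> 0)) => [|i _].
    by rewrite big1_eq scaler0 oppr0.
  exact: T0.
apply: eq_bigr => f _; rewrite -scalerBr weightE // -/D /T /signed.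
have [ch|_] := boolP (chosen b' f); last first.
  by rewrite mul0r scale0r big1 ?scaler0 ?oppr0 // => i _; rewrite mul0r scale0r.
have df : \det (normals f) != 0 by case/andP: ch.
rewrite !mulr1n normrEsg.
rewrite [X in X *: _](_ : _ =
  (Num.sg (\det (normals f)) * (D / \prod_j y (f j))) * \det (normals f)); last by ring.
rewrite -scalerA basic_pointB // scalerN scaler_sumr scaler_sumr; congr (- _).
apply: eq_bigr => i _; rewrite !scalerA; congr (_ *: _).
rewrite (bigD1 i) //= invfM -/y; field.
by rewrite y0 andbT; apply/prodf_neq0.
Qed.

Lemma height_basic_point_linear f l b v t :
  height (fun k => b k + t * v k) (basic_point (fun k => b k + t * v k) f) l =
  height b (basic_point b f) l + t * height v (basic_point v f) l.
Proof.
have -> : basic_point (fun k => b k + t * v k) f =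
    basic_point b f + t *: basic_point v f.
  rewrite /basic_point scalemxAl -mulmxDl scalerN -opprD; congr (- _ *m _).
  by apply/rowP => i; rewrite !mxE.
by rewrite /height slopeD slopeZ; ring.
Qed.

Lemma generic_perturbation b : (forall l, 0 < b l) ->
  exists b', [/\ generic b', exists f, chosen b' f &
                 forall f, chosen b' f -> feasible b (basic_point b f)].
Proof.
move=> b_gt0.
(* Nonzero heights at basic points give genericity, and preserved negative heights make each chosen
   [f] feasible for [b]. Preserved positive constants keep the origin feasible for [b'], so that
   some [f] is chosen. *)
pose phi (i : {ffun 'I_d -> L} * L + L) b :=
  match i with inl (f, l) => height b (basic_point b f) l | inr l => b l end.
have [|b' hb'] := perturbation (phi := phi) b.
  by move=> [[f l]|l] y v t //=; apply: height_basic_point_linear.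
exists b'; split.
- move=> f l df hl; have [_ _ ne0] := hb' (inl (f, l)).
  have [i /eqP fi|nf] := pickP (fun i => f i == l); first by exists i.
  have /ne0/eqP // : exists v, phi (inl (f, l)) v != 0.
  (* Raising only the constant of [l], a facet outside [f], leaves the basic point at 0 and gives
     height 1. *)
  exists (fun k => (k == l)%:R); rewrite /= /basic_point.
  rewrite (_ : \row_i _ = 0); last by apply/rowP => i; rewrite !mxE nf.
  by rewrite oppr0 mul0mx /height eqxx /slope mul0mx mxE addr0 oner_eq0.
- have [|f df fQ] := @feasible_basic_point b' 0; last first.
    by exists f; rewrite /chosen df; apply/forallP.
  move=> l; rewrite /height /slope mul0mx mxE addr0.
  by have [/(_ (b_gt0 l))/ltW] := hb' (inr l).
move=> f /andP[df /forallP fQ] l; have [_ neg _] := hb' (inl (f, l)).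
by rewrite leNgt; apply/negP => /neg /=; rewrite ltNge fQ.
Qed.

End Arrangement.

(** * Extreme points are the feasible basic points *)

Section ExtremePoints.
Variables (R : realFieldType) (d : nat) (L : finType) (a : L -> 'cV[R]_d).
Implicit Types (b : L -> R) (z u : 'rV[R]_d) (f : {ffun 'I_d -> L}) (l : L).

(** A positive combination of nonnegative heights vanishes only if each does, so [y] and [z] both
    solve the equations of the basis. *)
Lemma basic_point_extreme b f y z t : \det (normals a f) != 0 ->
    feasible a b y -> feasible a b z -> 0 < t < 1 ->
  basic_point a b f = t *: y + (1 - t) *: z -> y = z.
Proof.
move=> df yQ zQ /andP[t0 t1] e.
have h0 i : height a b y (f i) = 0 /\ height a b z (f i) = 0.
  have := height_basic_point b i df; have := yQ (f i); have := zQ (f i).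
  rewrite e /height slopeD !slopeZ => hz hy h.
  have : t * (b (f i) + slope a y (f i)) + (1 - t) * (b (f i) + slope a z (f i)) = 0.
    by rewrite -[RHS]h; ring.
  move/eqP; rewrite paddr_eq0 ?mulr_ge0 ?subr_ge0 ?(ltW t0) ?(ltW t1) //.
  rewrite !mulf_eq0 subr_eq0 (gt_eqF t0) (gt_eqF t1) /=.
  by move=> /andP[/eqP-> /eqP->].
by rewrite (basic_point_unique df (fun i => (h0 i).1))
           (basic_point_unique df (fun i => (h0 i).2)).
Qed.

(** If the tight normals did not span, small steps both ways along a direction orthogonal to them
    would stay feasible. *)
Lemma extreme_basic_point b z : feasible a b z ->
    (forall u, feasible a b (z + u) -> feasible a b (z - u) -> u = 0) ->
  exists2 f, \det (normals a f) != 0 & z = basic_point a b f.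
Proof.
move=> zQ ext.
have [u uT|f df fT] := @normals_basis _ _ _ a [pred l | height a b z l == 0].
  have [t t0 ht] := small_step (height a b z) (slope a u).
  have bnd l : `|t * slope a u l| <= height a b z l.
    rewrite -[leRHS]ger0_norm //.
    have [h0|/ht/ltW//] := eqVneq (height a b z l) 0.
    by rewrite uT ?inE ?h0 // mulr0 normr0.
  have /eqP : t *: u = 0.
    apply: ext => l; have := bnd l; rewrite ler_norml heightD.
      by rewrite slopeZ; lra.
    by rewrite -scaleNr slopeZ; lra.
  by rewrite scaler_eq0 gt_eqF //= => /eqP.
by exists f => //; apply: basic_point_unique => // i; apply/eqP/fT.
Qed.

End ExtremePoints.

(** * Races and the cube *)

Local Open Scope classical_set_scope.

Section Race.
Variables (R : realType) (n : nat).
Implicit Types (x v : 'rV[R]_n) (Q : seq (bterm R n)).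

Definition beval Q x : R := \sum_(t <- Q) bcoef t * bmono t x.

Lemma bmono_itv01 (t : bterm R n) x : unit_cube x -> 0 <= bmono t x <= 1.
Proof.
move=> x01.
have m01 i : 0 <= x ord0 i ^+ bexp1 t i * (1 - x ord0 i) ^+ bexp0 t i <= 1.
  have /andP[x0 x1] := x01 i.
  have [y0 y1] : 0 <= 1 - x ord0 i /\ 1 - x ord0 i <= 1 by split; lra.
  by rewrite mulr_ge0 ?mulr_ile1 ?exprn_ge0 ?exprn_ile1.
apply/andP; split; first by apply: prodr_ge0 => i _; case/andP: (m01 i).
by apply: prodr_ile1 => i _; apply: m01.
Qed.

Lemma beval_le Q x : unit_cube x -> bernstein_poly Q -> beval Q x <= bcoef_sum Q.
Proof.
move=> x01; elim: Q => [|t Q IH]; first by rewrite /beval /bcoef_sum !big_nil.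
move=> /andP[t0 /IH Q0]; rewrite /beval /bcoef_sum !big_cons lerD //.
by have /andP[_ m1] := bmono_itv01 t x01; rewrite ler_piMr // ltW.
Qed.

(** All rounds share the factor [1 / (C * m)], so summing the geometric series leaves output
    probabilities proportional to the values [beval (F v) x]. *)
Lemma race_factory (P : set 'rV[R]_n) (vs : seq 'rV[R]_n)
    (F : 'rV[R]_n -> seq (bterm R n)) C :
    (forall v, bernstein_poly (F v)) ->
    0 < C -> all (fun Q => bcoef_sum Q <= C) [seq F v | v <- vs] ->
    (forall x, P x -> open_unit_cube x ->
      0 < \sum_(v <- vs) beval (F v) x /\
      \sum_(v <- vs) beval (F v) x *: v = (\sum_(v <- vs) beval (F v) x) *: x) ->
  race_is_factory P vs [seq F v | v <- vs] C.
Proof.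
move=> F0 C0; rewrite all_map => /allP FC bary x Px ox.
have [S0 wx] := bary x Px ox.
have bigE (V : nmodType) (G : 'rV[R]_n -> V) :
    \sum_(v <- vs) G v = \sum_(k < size vs) G (nth 0 vs k).
  by rewrite (big_nth 0) big_mkord.
pose w (k : nat) := beval (F (nth 0 vs k)) x.
rewrite !bigE in S0 wx; set S := \sum_(k < size vs) _ in S0.
set Ps := [seq F v | v <- vs].
have x01 : unit_cube x by move=> i; have /andP[/ltW-> /ltW->] := ox i.
have sz : size Ps = size vs by apply: size_map.
set m : R := (size Ps)%:R.
have m_gt0 : 0 < m.
  rewrite ltr0n sz lt0n; apply: contraTneq S0 => e.
  by rewrite /S e big_ord0 ltxx.
have succE (k : 'I_(size vs)) : round_success Ps C k x = w k / (C * m).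
  rewrite /round_success (nth_map 0) // /w /beval -/m invfM mulr_suml mulr_sumr.
  by apply: eq_bigr => t _; ring.
have Cm0 : 0 < C * m by rewrite mulr_gt0.
have failE : round_fail Ps C x = 1 - S / (C * m).
  rewrite /round_fail [in LHS]sz /S mulr_suml; congr (_ - _).
  by apply: eq_bigr => k _; rewrite succE.
have S_le : S <= C * m.
  rewrite /m sz mulr_natr -[X in _ *+ X]card_ord -sumr_const; apply: ler_sum => k _.
  exact: le_trans (beval_le x01 (F0 _)) (FC _ (mem_nth 0 (ltn_ord k))).
set q := round_fail Ps C x in failE *.
have q0 : 0 <= q by rewrite failE subr_ge0 ler_pdivrMr ?mul1r.
have q1 : q < 1 by rewrite failE ltrBlDr ltrDl divr_gt0.
have nq1 : `|q| < 1 by rewrite ger0_norm.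
split; first exact: cvg_expr.
exists (fun k => w k / S); split=> [k|].
  have := @cvg_geometric_series R (round_success Ps C k x) q nq1.
  rewrite /race_out_prob (_ : _ / (1 - q) = w k / S); last first.
    by rewrite succE failE; field; rewrite !gt_eqF.
  move=> cvg_q; suff -> : (fun N : nat => \sum_(r < N)
      round_fail Ps C x ^+ r * round_success Ps C k x) =
      series (geometric (round_success Ps C k x) q) by exact: cvg_q.
  apply/funext => N.
  by rewrite /series /= big_mkord; apply: eq_bigr => r _; rewrite mulrC.
rewrite (eq_bigr (fun k : 'I__ => S^-1 *: (w k *: nth 0 vs k))) => [|k _].
  by rewrite -scaler_sumr wx scalerA mulVf ?scale1r ?gt_eqF.
by rewrite scalerA mulrC.
Qed.

End Race.

(** * The sliced cube in coordinates on the affine subspace *)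

Section Cube.
Variables (R : realType) (n : nat) (U : 'M[R]_n).
Let d := \rank U.
Let B : 'M[R]_(d, n) := row_base U.
Implicit Types (x p v : 'rV[R]_n) (z : 'rV[R]_d).

(* [(i, false)] indexes the facet [x_i >= 0] of the cube, [(i, true)] the facet
   [x_i <= 1]. *)
Definition facet x (l : 'I_n * bool) : R := if l.2 then 1 - x ord0 l.1 else x ord0 l.1.
Definition facet_normal (l : 'I_n * bool) : 'cV[R]_d :=
  if l.2 then - col l.1 B else col l.1 B.

Lemma slope_facet_normal u l :
  slope facet_normal u l = if l.2 then - (u *m B) ord0 l.1 else (u *m B) ord0 l.1.
Proof.
by case: l => i [] /=; rewrite /slope /facet_normal /= ?mulmxN !mxE;
  [congr (- _)|]; apply: eq_bigr => k _; rewrite !mxE.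
Qed.

Lemma height_facet p z l : height facet_normal (facet p) z l = facet (p + z *m B) l.
Proof.
by rewrite /height slope_facet_normal; case: l => i [] /=; rewrite /facet /= !mxE; ring.
Qed.

Lemma unit_cube_facet x : unit_cube x <-> forall l, 0 <= facet x l.
Proof.
split=> [x01 [i b]|x01 i].
  by have /andP[? ?] := x01 i; rewrite /facet; case: b => /=; rewrite ?subr_ge0.
have := x01 (i, false); have := x01 (i, true).
by rewrite /facet /= subr_ge0 => -> ->.
Qed.

Lemma affine_subP p x : affine_sub p U x <-> exists z, x = p + z *m B.
Proof.
rewrite /affine_sub /=.
have -> : (x - p <= U)%MS = (x - p <= B)%MS by rewrite /B (eq_row_base U).
split=> [/submxP [z e]|[z ->]].
  by exists z; rewrite -e addrC subrK.
by rewrite addrC addKr submxMl.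
Qed.

Lemma row_base_inj : injective (fun z => z *m B).
Proof. exact/row_free_inj/row_base_free. Qed.

(** Opposite facets of the cube have opposite slopes, so a nonzero coordinate of [u *m B] makes one
    of them decrease. *)
Lemma facet_normal_bounded (u : 'rV[R]_d) : u != 0 ->
  exists l, slope facet_normal u l < 0.
Proof.
move=> u0; have /rV0Pn [i ui] : u *m B != 0.
  by apply: contra_neq u0 => e; apply: row_base_inj; rewrite e mul0mx.
have [neg|] := ltP ((u *m B) ord0 i) 0; first by exists (i, false);
  rewrite slope_facet_normal.
rewrite le_eqVlt eq_sym (negPf ui) /= => pos.
by exists (i, true); rewrite slope_facet_normal /= oppr_lt0.
Qed.

Let P p := @unit_cube R n `&` affine_sub p U.

Lemma polytopeP p z : P p (p + z *m B) <-> feasible facet_normal (facet p) z.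
Proof.
split=> [[/unit_cube_facet x01 _] l|zQ]; first by rewrite height_facet.
split; last by apply/affine_subP; exists z.
by apply/unit_cube_facet => l; rewrite -height_facet.
Qed.

Definition basic_vertex p f : 'rV[R]_n := p + basic_point facet_normal (facet p) f *m B.

Lemma is_vertex_basic p v : is_vertex (P p) v -> exists f, v = basic_vertex p f.
Proof.
move=> [Pv ext]; have [_ /affine_subP [z e]] := Pv; subst v.
have [|u zDu zBu|f _ zf] := @extreme_basic_point _ _ _ facet_normal (facet p) z.
- exact/polytopeP.
(* The point is the midpoint of its translates by [u] and [- u], to which extremality applies. *)
- have t01 : 0 < (2^-1 : R) < 1 by apply/andP; split; lra.
  have := ext _ _ _ ((polytopeP p _).2 zDu) ((polytopeP p _).2 zBu) t01.
  rewrite !mulmxDl mulNmx => /(_ _)/addrI/addrI h.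
  have /h {h}e : p + z *m B =
      2^-1 *: (p + (z *m B + u *m B)) + (1 - 2^-1) *: (p + (z *m B - u *m B)).
    by apply/rowP => j; rewrite !mxE; field.
  apply: row_base_inj; rewrite mul0mx; apply/rowP => j.
  by have := congr1 (fun A : 'rV_n => A 0 j) e; rewrite !mxE; lra.
by exists f; rewrite /basic_vertex -zf.
Qed.

Lemma basic_is_vertex p f : \det (normals facet_normal f) != 0 ->
  feasible facet_normal (facet p) (basic_point facet_normal (facet p) f) ->
  is_vertex (P p) (basic_vertex p f).
Proof.
move=> df fQ; split; first exact/polytopeP.
move=> y z t Py Pz t01.
have [_ /affine_subP [y' ey]] := Py; have [_ /affine_subP [z' ez]] := Pz; subst y z.
rewrite /basic_vertex => e; congr (_ + _ *m _).
apply: (basic_point_extreme (b := facet p) df _ _ t01); try exact/polytopeP.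
apply: row_base_inj; apply: (addrI p); rewrite e.
by rewrite mulmxDl -!scalemxAl; apply/rowP => j; rewrite !mxE; ring.
Qed.

(** [undup] is there because several bases may define the same degenerate vertex. *)
Definition vertices p : seq 'rV[R]_n :=
  undup [seq v <- [seq basic_vertex p f | f : {ffun 'I_d -> 'I_n * bool}]
        | `[< is_vertex (P p) v >]].

Lemma mem_vertices p v : v \in vertices p <-> is_vertex (P p) v.
Proof.
rewrite mem_undup mem_filter; split=> [/andP[/asboolP]//|vP].
apply/andP; split; first exact/asboolP.
by have [f ->] := is_vertex_basic vP; apply: (codom_f (basic_vertex p)).
Qed.

Definition race_term (f : {ffun 'I_d -> 'I_n * bool}) : bterm R n :=
  BTerm `|\det (normals facet_normal f)|
    [ffun i => (d - #|[set j | f j == (i, false)]%SET|)%N]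
    [ffun i => (d - #|[set j | f j == (i, true)]%SET|)%N].

(** Collects the terms of all chosen bases that fall onto [v] once the perturbation is undone. *)
Definition race_poly p b' v : seq (bterm R n) :=
  [seq race_term f | f <- enum {ffun 'I_d -> 'I_n * bool} &
     chosen facet_normal b' f && (basic_vertex p f == v)].

Lemma bernstein_race_poly p b' v : bernstein_poly (race_poly p b' v).
Proof.
rewrite /bernstein_poly all_map all_filter; apply/allP => f _ /=.
by apply/implyP => /andP[/andP[df _] _]; rewrite normr_gt0.
Qed.

Lemma race_termE b' f x : chosen facet_normal b' f ->
  bcoef (race_term f) * bmono (race_term f) x = weight facet_normal b' (facet x) f.
Proof.
move=> ch; rewrite /weight ch mulr1n; congr (_ * _).
rewrite (eq_bigr (fun l : 'I_n * bool => (fun i c =>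
  facet x (i, c) ^+ (d - #|[set j | f j == (i, c)]%SET|)) l.1 l.2)) => [|[i c] _ //].
rewrite -(pair_bigA _ (fun i c =>
  facet x (i, c) ^+ (d - #|[set j | f j == (i, c)]%SET|))) /=.
by apply: eq_bigr => i _; rewrite big_bool /= !ffunE mulrC.
Qed.

Lemma beval_race_poly p b' v x : beval (race_poly p b' v) x =
  \sum_(f | chosen facet_normal b' f && (basic_vertex p f == v))
    weight facet_normal b' (facet x) f.
Proof.
rewrite /beval big_map big_filter big_enum_cond /=.
by apply: eq_bigr => f /andP[ch _]; apply: race_termE.
Qed.

Lemma race_poly_barycentric p b' x :
    generic facet_normal b' -> (exists f, chosen facet_normal b' f) ->
    (forall f, chosen facet_normal b' f ->
       feasible facet_normal (facet p) (basic_point facet_normal (facet p) f)) ->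
    P p x -> open_unit_cube x ->
  0 < \sum_(v <- vertices p) beval (race_poly p b' v) x /\
  \sum_(v <- vertices p) beval (race_poly p b' v) x *: v =
    (\sum_(v <- vertices p) beval (race_poly p b' v) x) *: x.
Proof.
move=> gen [f0 ch0] chP [_ /affine_subP [z xE]] ox.
pose w f := weight facet_normal b' (facet x) f.
have facet_gt0 l : 0 < facet x l.
  have /andP[x0 x1] := ox l.1.
  by rewrite /facet; case: l.2 => //; rewrite subr_gt0.
have w_ge0 f : 0 <= w f.
  by rewrite mulr_ge0 ?mulrn_wge0 ?prodr_ge0 // => l _; rewrite exprn_ge0 ?ltW.
have w_gt0 : 0 < w f0.
  rewrite /w /weight ch0 mulr_gt0 ?normr_gt0 //; first by case/andP: ch0.
  by apply: prodr_gt0 => l _; rewrite exprn_gt0.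
have in_vs f : chosen facet_normal b' f -> basic_vertex p f \in vertices p.
  by move=> ch; apply/mem_vertices/basic_is_vertex; [case/andP: ch|apply: chP].
(* A sum over vertices becomes a sum over bases, since each chosen basis lands on exactly one listed
   vertex. *)
have regroup (V : lmodType R) (F : 'rV[R]_n -> V) :
    \sum_(v <- vertices p) beval (race_poly p b' v) x *: F v =
    \sum_f w f *: F (basic_vertex p f).
  under eq_bigr do rewrite beval_race_poly scaler_suml.
  rewrite (exchange_big_dep (chosen facet_normal b')) /=; last by move=> v f _ /andP[].
  rewrite [RHS](bigID (chosen facet_normal b')) /= [X in _ + X]big1 ?addr0; last first.
    by move=> f /negPf nch; rewrite /w /weight nch mulr0n mul0r scale0r.
  apply: eq_bigr => f ch; rewrite ch /= -big_filter.
  rewrite (eq_filter (a2 := pred1 (basic_vertex p f))) => [|v]; last exact: eq_sym.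
  by rewrite filter_pred1_uniq ?undup_uniq ?in_vs // big_seq1.
have sumE : \sum_(v <- vertices p) beval (race_poly p b' v) x = \sum_f w f.
  rewrite -[LHS]mulr1 mulr_suml (regroup R^o (fun=> 1)).
  by apply: eq_bigr => f _; apply: mulr1.
have yE : height facet_normal (facet p) z = facet x.
  by apply/funext => l; rewrite height_facet xE.
split.
  rewrite sumE (bigD1 f0) //= ltr_pwDl //.
  by apply: sumr_ge0.
rewrite sumE (regroup _ id).
have := @sum_weight _ _ _ facet_normal facet_normal_bounded (facet p) b' z gen.
rewrite yE => /(_ (fun l => lt0r_neq0 (facet_gt0 l))) bary.
rewrite [in RHS]xE scalerDr scalemxAl -bary mulmx_suml scaler_suml -big_split /=.
by apply: eq_bigr => f _; rewrite /basic_vertex scalerDr scalemxAl.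
Qed.

End Cube.

Theorem theorem6p1 (R : realType) (n : nat) (p : 'rV[R]_n) (U : 'M[R]_n) :
  exists (vs : seq 'rV[R]_n) (Ps : seq (seq (bterm R n))),
    [/\ uniq vs,
        (forall v : 'rV[R]_n,
           v \in vs <-> is_vertex (@unit_cube R n `&` affine_sub p U) v),
        size Ps = size vs,
        all (@bernstein_poly R n) Ps &
        forall C : R, 1 <= C -> all (fun P => @bcoef_sum R n P <= C) Ps ->
          race_is_factory (@unit_cube R n `&` affine_sub p U) vs Ps C].
Proof.
have [[x0 [Px0 ox0]]|none] := pselect (exists x,
    (@unit_cube R n `&` affine_sub p U) x /\ open_unit_cube x); last first.
  (* Without a point in the open cube the factory condition is vacuous, and zero polynomials do. *)
  exists (vertices U p), (nseq (size (vertices U p)) [::]); split.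
  - exact: undup_uniq.
  - exact: mem_vertices.
  - by rewrite size_nseq.
  - by rewrite all_nseq orbT.
  - by move=> C _ _ x Px ox; case: none; exists x.
(* Moving the base point into the open cube makes all constants [facet x0 l] positive, as
   [generic_perturbation] requires. *)
have -> : affine_sub p U = affine_sub x0 U.
  have x0p : (x0 - p <= U)%MS by case: Px0.
  apply/seteqP; split=> x; rewrite /affine_sub /= => xU.
    by rewrite -[x](subrK p) -addrA -[p - x0]opprB addmx_sub // eqmx_opp.
  by rewrite -[x](subrK x0) -addrA addmx_sub.
have [|b' [gen ex chP]] :=
    generic_perturbation (@facet_normal_bounded R n U) (b := facet x0).
  move=> l; have /andP[? ?] := ox0 l.1.
  by rewrite /facet; case: l.2 => //; rewrite subr_gt0.
exists (vertices U x0), [seq race_poly U x0 b' v | v <- vertices U x0]; split.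
- exact: undup_uniq.
- exact: mem_vertices.
- by rewrite size_map.
- by rewrite all_map; apply/allP => v _; apply: bernstein_race_poly.
move=> C C1 PsC; apply: race_factory PsC _ => [v||x Px ox].
- exact: bernstein_race_poly.
- exact: lt_le_trans C1.
exact: race_poly_barycentric gen ex chP Px ox.
Qed.
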